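(* For every odd positive integer $m$ with $m\not\equiv 0 \pmod 3$, the Cartesian product graph $\Gamma(\mathbb{Z}_9)\times\Gamma(\mathbb{Z}_{3m})$ admits a distance antimagic labeling.
   Context: For an integer $n \geq 2$, the zero-divisor graph $\Gamma(\mathbb{Z}_n)$ is the simple graph whose vertex set is the set of nonzero zero-divisors of the ring $\mathbb{Z}_n$, two distinct vertices $u,v$ being adjacent iff $uv \equiv 0 \pmod n$. The Cartesian product $G\times H$ has vertex set $V(G)\times V(H)$, with $(u,v)$ adjacent to $(u',v')$ iff either $u=u'$ and $vv'\in E(H)$, or $v=v'$ and $uu'\in E(G)$. A distance antimagic labeling (DAML) of a graph $G$ with $N$ vertices is a bijection $f:V(G)\to\{1,\dots,N\}$ such that the weights $w(v)=\sum_{u\in N(v)} f(u)$, where $N(v)$ is the open neighbourhood of $v$, are pairwise distinct over all vertices $v$. A graph admits DAML if such a labeling exists. *)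

(* Defs.v *)
From mathcomp Require Import all_boot all_algebra.

Set Implicit Arguments.
Unset Strict Implicit.
Unset Printing Implicit Defensive.

Import GRing.Theory.

Record sgraph := SGraph {
  vertex :> finType;
  adj : rel vertex;
  adj_sym : symmetric adj;
  adj_irrefl : irreflexive adj
}.

(* MathComp's 'Z_n is the ring of integers mod n only for 1 < n ('Z_0 and 'Z_1
   are both Z/2), so everything below is meaningful only for 1 < n. *)
Definition nonzero_zero_divisor (n : nat) (x : 'Z_n) : bool :=
  (x != 0%R) && [exists y : 'Z_n, (y != 0%R) && ((x * y)%R == 0%R)].

Definition zdvertex (n : nat) : finType :=
  {x : 'Z_n | nonzero_zero_divisor x}.

Definition zdadj (n : nat) : rel (zdvertex n) :=
  fun u v => (u != v) && ((val u * val v)%R == 0%R).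

Lemma zdadj_sym (n : nat) : symmetric (@zdadj n).
Proof. by move=> u v; rewrite /zdadj eq_sym mulrC. Qed.

Lemma zdadj_irrefl (n : nat) : irreflexive (@zdadj n).
Proof. by move=> u; rewrite /zdadj eqxx. Qed.

Definition zero_divisor_graph (n : nat) : sgraph :=
  SGraph (@zdadj_sym n) (@zdadj_irrefl n).

Definition cartadj (G H : sgraph) : rel (vertex G * vertex H)%type :=
  fun p q => ((p.1 == q.1) && adj p.2 q.2) || ((p.2 == q.2) && adj p.1 q.1).

Lemma cartadj_sym (G H : sgraph) : symmetric (@cartadj G H).
Proof.
by move=> p q; rewrite /cartadj (eq_sym p.1) (eq_sym p.2) (adj_sym p.1) (adj_sym p.2).
Qed.

Lemma cartadj_irrefl (G H : sgraph) : irreflexive (@cartadj G H).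
Proof. by move=> p; rewrite /cartadj !adj_irrefl !andbF. Qed.

Definition cartesian_product (G H : sgraph) : sgraph :=
  SGraph (@cartadj_sym G H) (@cartadj_irrefl G H).

Definition weight (G : sgraph) (f : G -> nat) (v : G) : nat :=
  \sum_(u : G | adj v u) f u.

(* The first two conjuncts say that f is a bijection from G onto {1, ..., #|G|}. *)
Definition is_daml (G : sgraph) (f : G -> nat) : Prop :=
  [/\ injective f,
      forall k : nat, (exists v : G, f v = k) <-> (1 <= k <= #|G|)
    & injective (weight f)].

Definition admits_daml (G : sgraph) : Prop :=
  exists f : G -> nat, is_daml f.

(* Main.v *)
Require Import Defs.
From mathcomp Require Import all_boot all_algebra zify.

Set Implicit Arguments.
Unset Strict Implicit.
Unset Printing Implicit Defensive.

Import GRing.Theory.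

(* Gamma(Z_9) is an edge {3, 6}, so the product is a prism with two layers over
   H = Gamma(Z_n), n = 3m, |H| = N.  As n is odd, x <> -x, and the set A(x) of
   nonzero annihilators of x is closed under negation.  Give one layer the odd
   labels, with f(x) + f(-x) = 2N, and the other one the even labels, with
   f(x) + f(-x) = 2N + 2.  Then the labels of A(x) sum to 2aN or a(2N + 2),
   where 2a = |A(x)| = gcd(x, n) - 1.  If x^2 <> 0, the weight of x is this sum
   plus the label of x in the other layer, so layer, a and label can be read off
   from it.  If x^2 = 0, then x lies in A(x) and only a difference of two labels
   is added; but gcd(x, n) is then divisible by every prime factor of n, so that
   its gcd with every other gcd(y, n) is an odd number > 1 and the values of a
   are equal or differ by at least 3.  Collisions can then only occur between
   square-zero elements with the same a.  Number the pairs {x, -x} by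
   r = 1, ..., N/2 and give x the labels 2r - 1 and 4r: the differences of labels
   are 2r + 1 at x and 1 - 2r at -x, hence distinct, and ranking the square-zero
   pairs last keeps the sums of two of these differences away from 2a. *)

(** * Weights in a Cartesian product *)

Lemma weight_cartesian_product (G H : sgraph)
    (f : cartesian_product G H -> nat) (x : G) (y : H) :
  weight f (x, y) =
    weight (fun x' : G => f (x', y)) x + weight (fun y' : H => f (x, y')) y.
Proof.
rewrite /weight (bigID (fun u : cartesian_product G H => u.2 == y)) /=.
congr (_ + _).
  rewrite (reindex_onto (fun x' : G => (x', y)) (fun u => u.1)) /=; last first.
    by move=> [x' y'] /= /andP[_ /eqP ->].
  apply: eq_bigl => x'; rewrite /cartadj /= adj_irrefl !eqxx andbF.
  by rewrite !andbT.
rewrite (reindex_onto (fun y' : H => (x, y') : cartesian_product G H)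
  (fun u => u.2)) /=; last first.
  move=> [x' y'] /=; rewrite /cartadj /= (eq_sym y y').
  move=> /andP[hadj /negPf ney].
  by move: hadj; rewrite ney orbF => /andP[/eqP ->].
apply: eq_bigl => y'; rewrite /cartadj /= adj_irrefl !eqxx andbF orbF andbT /=.
by case: eqP => [->|]; rewrite ?adj_irrefl ?andbT.
Qed.

(** * Pairs under a fixed-point-free involution: sums, sizes and ranks *)

Section Involution.

Variables (V : finType) (opp : V -> V) (pos : pred V).
Hypothesis oppK : involutive opp.
Hypothesis pos_opp : forall v, pos (opp v) = ~~ pos v.

Lemma sum_opp_pairs (P : pred V) (f : V -> nat) :
    (forall v, P (opp v) = P v) ->
  \sum_(v | P v) f v = \sum_(v | P v && pos v) (f v + f (opp v)).
Proof.
move=> P_opp; rewrite [LHS](bigID pos) big_split /=; congr (_ + _).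
rewrite (reindex_inj (inv_inj oppK)) /=.
by apply: eq_bigl => v; rewrite P_opp pos_opp negbK.
Qed.

Lemma card_opp_pairs (P : pred V) : (forall v, P (opp v) = P v) ->
  #|P| = (#|[pred v | P v && pos v]|).*2.
Proof.
move=> P_opp; rewrite -sum1_card (sum_opp_pairs _ P_opp).
by rewrite sum_nat_const muln2.
Qed.

Lemma sum_opp_const (P : pred V) (f : V -> nat) (K : nat) :
    (forall v, P (opp v) = P v) -> (forall v, f v + f (opp v) = K) ->
  \sum_(v | P v) f v = #|[pred v | P v && pos v]| * K.
Proof.
move=> P_opp fK; rewrite (sum_opp_pairs _ P_opp) -sum_nat_const.
by apply: eq_bigr.
Qed.

Variable Q : pred V.
Hypothesis Q_opp : forall v, Q (opp v) = Q v.

Let pos_seq :=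
  [seq v <- enum V | ~~ Q v && pos v] ++ [seq v <- enum V | Q v && pos v].

Definition pos_rep (v : V) : V := if pos v then v else opp v.

(* Numbers the pairs [{v, opp v}] from 1, those in [Q] last. *)
Definition pair_rank (v : V) : nat := (index (pos_rep v) pos_seq).+1.

Lemma pos_pos_rep v : pos (pos_rep v).
Proof. by rewrite /pos_rep; case: ifP => // pv; rewrite pos_opp pv. Qed.

Lemma Q_pos_rep v : Q (pos_rep v) = Q v.
Proof. by rewrite /pos_rep; case: ifP. Qed.

Lemma pos_rep_opp v : pos_rep (opp v) = pos_rep v.
Proof. by rewrite /pos_rep pos_opp; case: (pos v); rewrite ?oppK. Qed.

Lemma mem_pos_seq v : (v \in pos_seq) = pos v.
Proof.
by rewrite mem_cat !mem_filter -enumT mem_enum !andbT; case: (Q v); rewrite //= orbF.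
Qed.

Lemma pair_rank_opp v : pair_rank (opp v) = pair_rank v.
Proof. by rewrite /pair_rank pos_rep_opp. Qed.

Lemma pair_rank_inj u v :
  pair_rank u = pair_rank v -> pos u = pos v -> u = v.
Proof.
move=> [] /(congr1 (nth u pos_seq)).
rewrite !nth_index ?mem_pos_seq ?pos_pos_rep // /pos_rep => + epos.
by rewrite epos; case: (pos v) => // /(inv_inj oppK).
Qed.

Lemma card_filter_enum (P : pred V) : size [seq v <- enum V | P v] = #|P|.
Proof. by rewrite cardE enumT. Qed.

(** [pos_seq] lists one representative of each pair, so its length is half of [#|V|]. *)
Lemma pair_rank_le v : (pair_rank v).*2 <= #|V|.
Proof.
have -> : #|V| = (size pos_seq).*2.
  rewrite size_cat !card_filter_enum doubleD.
  rewrite -(card_opp_pairs (P := predC Q)) => [|u /=]; last by rewrite Q_opp.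
  by rewrite -(card_opp_pairs Q_opp) addnC cardC.
by rewrite leq_double index_mem mem_pos_seq pos_pos_rep.
Qed.

(** All pairs outside [Q] are ranked before [v], and there are [(#|V| - #|Q|) / 2] of them. *)
Lemma pair_rank_gt v : Q v -> #|V| < (pair_rank v).*2 + #|Q|.
Proof.
move=> Qv; rewrite -(cardC Q) addnC ltn_add2r.
rewrite (card_opp_pairs (P := predC Q)) => [|u /=]; last by rewrite Q_opp.
rewrite ltn_double ltnS /pair_rank index_cat mem_filter Q_pos_rep Qv /=.
by rewrite card_filter_enum leq_addr.
Qed.

End Involution.

(** * Arithmetic of the labels and of the resulting weights *)

(* [b] is the layer, [p] tells which element of its pair a vertex is, and [r] is
   the rank of the pair; for [2 * r <= N] the subtractions do not truncate. *)
Definition layer_label (N : nat) (b p : bool) (r : nat) : nat :=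
  if b then if p then 4 * r else 2 * N + 2 - 4 * r
  else if p then 2 * r - 1 else 2 * N + 1 - 2 * r.

Lemma layer_label_bounds N b p r :
  0 < r -> 2 * r <= N -> 0 < layer_label N b p r <= 2 * N.
Proof. by rewrite /layer_label; case: b p => [] []; lia. Qed.

(** The layers differ in parity. In the even layer the two kinds of label differ modulo 4 because
    [N] is even; in the odd layer they lie below and above [N]. *)
Lemma layer_label_inj N b b' p p' r r' : ~~ odd N ->
    0 < r -> 2 * r <= N -> 0 < r' -> 2 * r' <= N ->
    layer_label N b p r = layer_label N b' p' r' ->
  [/\ b = b', p = p' & r = r'].
Proof.
rewrite /layer_label => N_even r_gt0 rN r'_gt0 r'N.
by case: b b' p p' => [] [] [] [] h; split=> //; lia.
Qed.

Lemma mul_gap a a' t N : a + t <= a' -> a * N + t * N <= a' * N.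
Proof. by move=> h; rewrite -mulnDl leq_mul2r h orbT. Qed.

(** Here [c] marks a square-zero vertex and [q] counts them. A gap of 3 in [a] outweighs all label
    terms. For equal [a], a collision across layers needs [r + r' + 1 = a], excluded by the high
    ranks and [a + q <= N], or [r - r' + 1 = a] up to exchanging [r] and [r'], excluded by
    [q + 2 <= 2 * a]. *)
Lemma layer_weight_inj N q a a' r r' (b b' p p' c c' : bool) w : ~~ odd N ->
    0 < r -> 2 * r <= N -> 0 < r' -> 2 * r' <= N ->
    2 * a <= N -> 2 * a' <= N ->
    (c -> [/\ N < 2 * r + q, q + 2 <= 2 * a & a + q <= N]) ->
    (c' -> [/\ N < 2 * r' + q, q + 2 <= 2 * a' & a' + q <= N]) ->
    c || c' -> [\/ a = a' /\ c = c', a + 3 <= a' | a' + 3 <= a] ->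
    w + c * layer_label N b p r =
      layer_label N (~~ b) p r + a * (2 * N + 2 * b) ->
    w + c' * layer_label N b' p' r' =
      layer_label N (~~ b') p' r' + a' * (2 * N + 2 * b') ->
  [/\ b = b', p = p' & r = r'].
Proof.
move=> N_even r_gt0 rN r'_gt0 r'N aN a'N hc hc' cc' cmp.
have aDr (x : nat) (e : bool) : x * (2 * N + 2 * e) = 2 * (x * N) + 2 * x * e by lia.
(* The products become atoms, so that [lia] faces a linear problem; [mul_gap] supplies what it must
   know about them. *)
rewrite !aDr; set P := a * N; set P' := a' * N.
have {cmp} : [\/ [/\ a = a', P = P' & c = c'], a + 3 <= a' /\ P + 3 * N <= P'
            | a' + 3 <= a /\ P' + 3 * N <= P].
  case: cmp => [[ea ec]|h|h]; [apply: Or31|apply: Or32|apply: Or33].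
  - by rewrite /P /P' ea.
  - by split=> //; apply: mul_gap.
  - by split=> //; apply: mul_gap.
move: P P' => P P' cmp; clear aDr.
rewrite /layer_label.
case: c c' cc' hc hc' cmp => [] [] // _ => [/(_ isT)[h1 h2 h3] /(_ isT)[h4 h5 h6]
  |/(_ isT)[h1 h2 h3] _|_ /(_ isT)[h4 h5 h6]];
by case=> [[ea eP ec]|[ha hP]|[ha hP]]; case: b b' p p' => [] [] [] [] /= w1 w2;
  split=> //; lia.
Qed.

(** The parity of [w] gives the layer; a label is positive and at most the period [2 * N + 2 * b],
    so [a] and the label follow as in a division. *)
Lemma layer_weight_inj_nil N a a' r r' (b b' p p' : bool) w : ~~ odd N ->
    0 < r -> 2 * r <= N -> 0 < r' -> 2 * r' <= N ->
    w = layer_label N (~~ b) p r + a * (2 * N + 2 * b) ->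
    w = layer_label N (~~ b') p' r' + a' * (2 * N + 2 * b') ->
  [/\ b = b', p = p' & r = r'].
Proof.
move=> N_even r_gt0 rN r'_gt0 r'N.
have aDr (x : nat) (e : bool) : x * (2 * N + 2 * e) = 2 * (x * N) + 2 * x * e by lia.
rewrite !aDr; set P := a * N; set P' := a' * N.
have : [\/ a = a' /\ P = P', a + 1 <= a' /\ P + 1 * N <= P'
            | a' + 1 <= a /\ P' + 1 * N <= P].
  case: (ltngtP a a') => [h|h|e]; [apply: Or32|apply: Or33|by apply: Or31; rewrite /P /P' e].
  - by split; [lia|apply: mul_gap; lia].
  - by split; [lia|apply: mul_gap; lia].
move: P P' => P P' cmp; clear aDr.
rewrite /layer_label.
by case: cmp => [[ea eP]|[ha hP]|[ha hP]]; case: b b' p p' => [] [] [] [] /= w1 w2;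
  split=> //; lia.
Qed.

(** * Labeling a two-layer prism over a graph with an involution *)

Section PrismLabeling.

Variables (G H : sgraph) (layer : G -> bool) (opp : H -> H) (pos : pred H).
Variable A : rel H.
Hypothesis layer_bij : bijective layer.
Hypothesis adjG : forall x y : G, adj x y = (x != y).
Hypothesis adjH : forall u v : H, adj u v = A u v && (v != u).
Hypothesis oppK : involutive opp.
Hypothesis pos_opp : forall v, pos (opp v) = ~~ pos v.
Hypothesis A_opp : forall u v, A u (opp v) = A u v.
Hypothesis loop_opp : forall v, A (opp v) (opp v) = A v v.

Let loop : pred H := fun v => A v v.
(** Half the size of [A v], which is closed under [opp]. *)
Let half (v : H) : nat := #|[pred u | A v u && pos u]|.

Hypothesis half_gap : forall u v, loop u ->
  [\/ half u = half v /\ loop v, half u + 3 <= half v | half v + 3 <= half u].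
Hypothesis loop_half : forall v, loop v -> #|loop| + 2 <= 2 * half v.
Hypothesis half_loop : forall v, loop v -> half v + #|loop| <= #|H|.

Let N := #|H|.
Let rank : H -> nat := pair_rank opp pos loop.
Let lab (b : bool) (v : H) : nat := layer_label N b (pos v) (rank v).

Let rank_gt0 v : 0 < rank v. Proof. by []. Qed.

Let rank_le v : 2 * rank v <= N.
Proof. by rewrite mul2n; apply: pair_rank_le. Qed.

Let N_even : ~~ odd N.
Proof. by rewrite /N (card_opp_pairs oppK pos_opp (P := predT)) ?odd_double. Qed.

Let half_le v : 2 * half v <= N.
Proof.
rewrite mul2n /half -(card_opp_pairs oppK pos_opp (P := A v)) => [|u].
  exact: max_card.
exact: A_opp.
Qed.

Let lab_opp b v : lab b v + lab b (opp v) = 2 * N + 2 * b.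
Proof.
rewrite /lab /rank pair_rank_opp // -/rank pos_opp /layer_label.
move: (rank v) (rank_gt0 v) (rank_le v) => r r_gt0 rN.
by case: b (pos v) => [] [] /=; lia.
Qed.

Let lab_inj b b' v v' : lab b v = lab b' v' -> b = b' /\ v = v'.
Proof.
move=> /(layer_label_inj N_even (rank_gt0 v) (rank_le v) (rank_gt0 v') (rank_le v')).
by case=> -> epos /(pair_rank_inj oppK pos_opp) ->.
Qed.

(** Adding the label of [v] back when [v] lies in [A v] completes the sum over all of [A v], and
    avoids a truncated subtraction. *)
Let weight_lab b v :
  weight (lab b) v + loop v * lab b v = half v * (2 * N + 2 * b).
Proof.
rewrite -(sum_opp_const oppK pos_opp (P := A v) _ (lab_opp b)) //.
rewrite /weight [RHS](bigID (pred1 v)) /= addnC; congr (_ + _).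
  rewrite big_mkcondl /= big_pred1_eq /loop.
  by case: (A v v); rewrite ?mul1n.
by apply: eq_bigl => u; rewrite adjH.
Qed.

Let f (p : cartesian_product G H) : nat := lab (layer p.1) p.2.

Let weight_f b v (x : G) : layer x = b ->
  weight f (x, v) + loop v * lab b v = lab (~~ b) v + half v * (2 * N + 2 * b).
Proof.
move=> <-; rewrite weight_cartesian_product -addnA; congr (_ + _); last exact: weight_lab.
case: layer_bij => layer' layerK layer'K.
(* The only neighbour of [x] in [G] is the vertex of the other layer. *)
rewrite /weight (big_pred1 (layer' (~~ layer x))) => [|y].
  by rewrite /f /= layer'K.
rewrite adjG /= -(inj_eq (can_inj layerK)) -[RHS](inj_eq (can_inj layerK)) layer'K.
by case: (layer x) (layer y) => [] [].
Qed.

Let weight_f_inj : injective (weight f).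
Proof.
case=> x v [x' v'] e.
have [] : [/\ layer x = layer x', pos v = pos v' & rank v = rank v'].
  have w1 := weight_f v (erefl (layer x)).
  have w2 := weight_f v' (erefl (layer x')).
  rewrite -e in w2.
  have [|] := boolP (loop v || loop v'); last first.
    rewrite negb_or => /andP[/negPf l1 /negPf l2]; move: w1 w2.
    rewrite l1 l2 !addn0.
    exact: layer_weight_inj_nil.
  move=> ll; apply: (layer_weight_inj (q := #|loop|) _ _ _ _ _ _ _ _ _ ll _ w1 w2) => //.
  - move=> lv; split; [|exact: loop_half|exact: half_loop].
    by rewrite mul2n; apply: pair_rank_gt.
  - move=> lv; split; [|exact: loop_half|exact: half_loop].
    by rewrite mul2n; apply: pair_rank_gt.
  case/orP: ll => [l1|l2].
    by case: (half_gap v' l1) => [[-> ->]|h|h]; [apply: Or31|apply: Or32|apply: Or33].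
  by case: (half_gap v l2) => [[-> ->]|h|h]; [apply: Or31|apply: Or33|apply: Or32].
move=> /(bij_inj layer_bij) -> epos erank; congr pair.
exact: (pair_rank_inj oppK pos_opp erank epos).
Qed.

Lemma prism_admits_daml : admits_daml (cartesian_product G H).
Proof.
have f_inj : injective f.
  by move=> [x v] [x' v'] /lab_inj[/(bij_inj layer_bij) /= -> /= ->].
have f_bounds p : 0 < f p <= 2 * N by apply: layer_label_bounds.
have cardGH : #|cartesian_product G H| = 2 * N.
  by rewrite /= card_prod (bij_eq_card layer_bij) card_bool.
exists f; split=> // k; rewrite cardGH; split=> [[v <-] //|k_bounds].
have k1 : k.-1 < 2 * N by lia.
have lt_f p : (f p).-1 < 2 * N by have := f_bounds p; lia.
(* Surjectivity by counting: labels shifted down by 1 inject into an ordinal type of the same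
   size. *)
pose g p := Ordinal (lt_f p).
have g_inj : injective g.
  move=> p p' /(congr1 val) /= e; apply: f_inj.
  by have := f_bounds p; have := f_bounds p'; lia.
have [|g' _ g'K] := inj_card_bij g_inj; first by rewrite card_ord cardGH.
exists (g' (Ordinal k1)).
have /(congr1 val) /= := g'K (Ordinal k1).
by have := f_bounds (g' (Ordinal k1)); lia.
Qed.

End PrismLabeling.

(** * Annihilators and negation in the integers modulo [n] *)

Lemma Zp_mul_eq0 n (x y : 'Z_n) : 1 < n -> ((x * y)%R == 0%R) = (n %| x * y).
Proof. by move=> n_gt1; rewrite -val_eqE /= [X in _ %% X]Zp_cast. Qed.

Lemma val_Zp_opp n (x : 'Z_n) : 1 < n -> x != 0%R ->
  (- x)%R = n - x :> nat.
Proof.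
rewrite -val_eqE /= -lt0n => n_gt1 x_gt0.
by rewrite [X in _ %% X]Zp_cast // [X in X - _]Zp_cast // modn_small //; lia.
Qed.

Lemma card_Zp_annihilator n (x : 'Z_n) : 1 < n ->
  #|[pred y : 'Z_n | (x * y)%R == 0%R]| = gcdn x n.
Proof.
move=> n_gt1; have n_gt0 : 0 < n by lia.
set d := gcdn x n; have d_gt0 : 0 < d by rewrite gcdn_gt0 n_gt0 orbT.
have nE : n = (n %/ d) * d by rewrite divnK ?dvdn_gcdr.
have e_gt0 : 0 < n %/ d by rewrite divn_gt0 // dvdn_leq ?dvdn_gcdr.
(* After division by [d], [x] and [n] are coprime; the annihilator is thus the set of the [d]
   multiples of [n %/ d] below [n]. *)
have multE (k : nat) : (n %| x * k) = (n %/ d %| k).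
  rewrite {1}nE -{1}(divnK (dvdn_gcdl x n)) -/d mulnAC dvdn_pmul2r //.
  rewrite Gauss_dvdr // coprime_sym /coprime -(eqn_pmul2r d_gt0) muln_gcdl.
  by rewrite !divnK ?dvdn_gcdl ?dvdn_gcdr // mul1n.
have lt_mul (k : 'I_d) : n %/ d * k < (Zp_trunc n).+2.
  by rewrite Zp_cast // [ltnRHS]nE ltn_pmul2l.
pose g (k : 'I_d) : 'Z_n := Ordinal (lt_mul k).
have g_inj : injective g.
  move=> k k' /(congr1 val) /eqP /=; rewrite eqn_pmul2l // => /eqP.
  exact: val_inj.
rewrite -[RHS]card_ord -(card_image g_inj); apply: eq_card => y; rewrite !inE.
rewrite Zp_mul_eq0 // multE; apply/idP/imageP => [/dvdnP[k yE]|[k _ ->]]; last first.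
  exact: dvdn_mulr.
have lt_k : k < d.
  rewrite -(ltn_pmul2r e_gt0) -yE [ltnRHS]mulnC -nE.
  by have := ltn_ord y; rewrite [ltnRHS]Zp_cast.
by exists (Ordinal lt_k) => //; apply: val_inj; rewrite /= mulnC.
Qed.

Lemma nonzero_zero_divisorE n (x : 'Z_n) : 1 < n ->
  nonzero_zero_divisor x = (x != 0%R) && (1 < gcdn x n).
Proof.
move=> n_gt1; rewrite /nonzero_zero_divisor -card_Zp_annihilator //.
rewrite (cardD1 0%R) inE mulr0 eqxx; congr (_ && _).
apply/existsP/idP => [[y /andP[y0 xy]]|].
  by apply/card_gt0P; exists y; rewrite !inE y0.
by move=> /card_gt0P[y]; rewrite !inE => y0; exists y.
Qed.

Lemma zdvertex_neq0 n (v : zdvertex n) : val v != 0%R.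
Proof. by case/andP: (valP v). Qed.

(** A nonzero annihilator of a vertex is itself a vertex, so only 0 is missing from the count. *)
Lemma card_zdvertex_annihilator n (v : zdvertex n) : 1 < n ->
  (#|[pred u : zdvertex n | (val v * val u)%R == 0%R]|).+1 = gcdn (val v) n.
Proof.
move=> n_gt1; rewrite -card_Zp_annihilator // [RHS](cardD1 0%R) inE mulr0 eqxx.
rewrite add1n; congr _.+1; rewrite -(card_image val_inj); apply: eq_card => y.
rewrite !inE; apply/imageP/andP => [[u uv ->]|[y0 vy]].
  by rewrite zdvertex_neq0.
have y_zd : nonzero_zero_divisor y.
  rewrite /nonzero_zero_divisor y0; apply/existsP; exists (val v).
  by rewrite zdvertex_neq0 mulrC.
by exists (Sub y y_zd); rewrite ?inE SubK.
Qed.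

Lemma nonzero_zero_divisorN n (x : 'Z_n) :
  nonzero_zero_divisor x -> nonzero_zero_divisor (- x)%R.
Proof.
move=> /andP[x0 /existsP[y /andP[y0 xy]]].
rewrite /nonzero_zero_divisor oppr_eq0 x0; apply/existsP; exists y.
by rewrite y0 mulNr oppr_eq0.
Qed.

Definition zdopp n (v : zdvertex n) : zdvertex n :=
  Sub (- val v)%R (nonzero_zero_divisorN (valP v)).

(** For odd [n], exactly one of [x] and [n - x] lies below [n / 2]. *)
Definition zdpos n (v : zdvertex n) : bool := 2 * val v < n.

Lemma zdoppK n : involutive (@zdopp n).
Proof. by move=> v; apply: val_inj; rewrite !SubK opprK. Qed.

Lemma zdpos_opp n (v : zdvertex n) : 1 < n -> odd n ->
  zdpos (zdopp v) = ~~ zdpos v.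
Proof.
move=> n_gt1 n_odd; rewrite /zdpos.
have -> : val (zdopp v) = n - val v :> nat := val_Zp_opp n_gt1 (zdvertex_neq0 v).
by have := ltn_ord (val v); rewrite [ltnRHS]Zp_cast //; lia.
Qed.

(** * The zero-divisor graph of Z_9 as a single edge *)

Definition zdlayer9 (x : zdvertex 9) : bool := val x == 3 :> nat.

Lemma zdvertex9 (x : zdvertex 9) : val x = (if zdlayer9 x then 3 else 6) :> nat.
Proof.
have := valP x; rewrite nonzero_zero_divisorE // /zdlayer9.
by case: (val x) => [[|[|[|[|[|[|[|[|[|k]]]]]]]]] //= klt].
Qed.

Lemma zdlayer9_bij : bijective zdlayer9.
Proof.
have zd3 : nonzero_zero_divisor (inZp 3 : 'Z_9) by rewrite nonzero_zero_divisorE.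
have zd6 : nonzero_zero_divisor (inZp 6 : 'Z_9) by rewrite nonzero_zero_divisorE.
exists (fun b : bool => if b then Sub _ zd3 else Sub _ zd6).
  by move=> x; apply/val_inj/ord_inj; rewrite [RHS]zdvertex9; case: (zdlayer9 x).
by case.
Qed.

Lemma zdadj9 (x y : zero_divisor_graph 9) : adj x y = (x != y).
Proof.
rewrite /= /zdadj Zp_mul_eq0 // !zdvertex9.
by case: (zdlayer9 x) (zdlayer9 y) => [] []; rewrite andbT.
Qed.

(** * Gcds with [n] and square-zero elements *)

Lemma nilpotent_common_prime n x y : n %| x ^ 2 -> 1 < gcdn y n ->
  exists2 p, prime p & p %| gcdn x n /\ p %| gcdn y n.
Proof.
move=> nx d_gt1; have [p p_pr p_d] := pdivP d_gt1.
have /andP[py pn] : (p %| y) && (p %| n) by rewrite -dvdn_gcd.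
exists p => //; split=> //; rewrite dvdn_gcd pn andbT.
by have := dvdn_trans pn nx; rewrite Euclid_dvdX // andbT.
Qed.

(** The prime [p] is odd and divides [2 * (b - a)], hence divides [b - a], and [p >= 3]. *)
Lemma odd_common_prime_gap p a b : prime p ->
  p %| 2 * a + 1 -> p %| 2 * b + 1 -> a < b -> a + 3 <= b.
Proof.
move=> p_pr pa pb ltab; have p_odd : odd p by apply: dvdn_odd pa _; lia.
have : p %| 2 * (b - a) by rewrite mulnBr -(subnDr 1) dvdn_sub.
rewrite Gauss_dvdr ?coprimen2 // => /dvdn_leq.
by have := odd_prime_gt2 p_odd p_pr; lia.
Qed.

(** Shows that having square zero depends only on the gcd with [n]. *)
Lemma dvdn_gcd_sqr n x : (n %| x ^ 2) = (n %| gcdn x n ^ 2).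
Proof.
rewrite -!mulnn muln_gcdr dvdn_gcd (dvdn_mull _ (dvdnn n)) andbT.
by rewrite muln_gcdl dvdn_gcd (dvdn_mulr x (dvdnn n)) andbT.
Qed.

(** * The numerical hypotheses of the prism for Z_{3m} *)

Section ZeroDivisorGraph3m.

Variable m : nat.
Hypotheses (m_odd : odd m) (m_mod3 : ~~ (3 %| m)).

Let n := 3 * m.
Let V := zdvertex n.
Let ann : rel V := fun u v => (val u * val v)%R == 0%R.
Let loop : pred V := fun v => ann v v.
Let half (v : V) : nat := #|[pred u | ann v u && zdpos u]|.

Let n_gt1 : 1 < n. Proof. by rewrite /n; lia. Qed.
Let n_odd : odd n. Proof. by rewrite /n; lia. Qed.

Let annE u v : ann u v = (n %| val u * val v).
Proof. exact: Zp_mul_eq0. Qed.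

Let annN u v : ann u (zdopp v) = ann u v.
Proof. by rewrite /ann SubK mulrN oppr_eq0. Qed.

Let loop_opp v : loop (zdopp v) = loop v.
Proof. by rewrite /loop annN /ann SubK mulNr oppr_eq0. Qed.

Let loopE v : loop v = (n %| val v ^ 2).
Proof. by rewrite /loop annE mulnn. Qed.

Let pos_opp (v : V) : zdpos (zdopp v) = ~~ zdpos v.
Proof. exact: zdpos_opp. Qed.

Let card_ann v : #|ann v| = 2 * half v.
Proof. by rewrite mul2n; apply: card_opp_pairs (@zdoppK n) pos_opp _ (annN v). Qed.

Let halfE v : 2 * half v + 1 = gcdn (val v) n.
Proof. by rewrite -card_ann addn1 card_zdvertex_annihilator. Qed.

Let gcd_gt1 (v : V) : 1 < gcdn (val v) n.
Proof. by have := valP v; rewrite nonzero_zero_divisorE // => /andP[]. Qed.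

Let half_gap u v : loop u ->
  [\/ half u = half v /\ loop v, half u + 3 <= half v | half v + 3 <= half u].
Proof.
rewrite loopE => nu; have [p p_pr []] := nilpotent_common_prime nu (gcd_gt1 v).
rewrite -!halfE => pu pv; case: (ltngtP (half u) (half v)) => [uv|vu|e].
- exact: Or32 (odd_common_prime_gap p_pr pu pv uv).
- exact: Or33 (odd_common_prime_gap p_pr pv pu vu).
apply: Or31; split=> //.
by rewrite loopE dvdn_gcd_sqr -halfE -e halfE -dvdn_gcd_sqr.
Qed.

Let loop3 v : loop v -> 3 %| val v.
Proof.
rewrite loopE => /(dvdn_trans (dvdn_mulr m (dvdnn 3))).
by rewrite Euclid_dvdX // andbT.
Qed.

Let val_gt0 (v : V) : 0 < val v.
Proof. by rewrite lt0n; have := zdvertex_neq0 v; rewrite -val_eqE. Qed.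

Let val_lt (v : V) : val v < n.
Proof. by have := ltn_ord (val v); rewrite [ltnRHS]Zp_cast. Qed.

(** A square-zero vertex is a positive multiple of 3 below [3 * m]; this forces [m > 1], so that
    [m], with gcd [m], is a zero-divisor. *)
Let vertex_m (v : V) : loop v -> exists u : V, val u = m :> nat.
Proof.
move=> /loop3/(dvdn_leq (val_gt0 v)) v_ge3.
have m_gt1 : 1 < m by have := leq_ltn_trans v_ge3 (val_lt v); rewrite /n; lia.
have mval : (m%:R : 'Z_n)%R = m :> nat by rewrite val_Zp_nat // modn_small // /n; lia.
have m_zd : nonzero_zero_divisor (m%:R : 'Z_n)%R.
  rewrite nonzero_zero_divisorE // mval -val_eqE /= mval /n.
  by rewrite (gcdn_idPl (dvdn_mull _ _)) // m_gt1 andbT; lia.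
by exists (Sub _ m_zd); rewrite SubK.
Qed.

Let loop_half v : loop v -> #|loop| + 2 <= 2 * half v.
Proof.
move=> lv; have [w wm] := vertex_m lv.
have : #|loop| < #|ann v|.
  apply/proper_card/properP; split.
    apply/subsetP => u; rewrite !unfold_in -/(loop u) -/(ann v u) annE => lu.
    (* Square-zero elements annihilate each other: [n] divides both squares, so [n ^ 2] divides the
       square of the product. *)
    rewrite -(dvdn_pexp2r _ _ (k := 2)) // expnMn [n ^ 2]expnS expn1.
    by apply: dvdn_mul; rewrite -loopE.
  (* The vertex [m] makes the inclusion strict: it annihilates [v] as 3 divides [v], but is not
     square-zero as 3 does not divide [m]. *)
  exists w; rewrite unfold_in -?/(loop w) -?/(ann v w).
    by rewrite annE wm; apply: dvdn_mul (loop3 lv) (dvdnn m).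
  apply/negP => /loop3; rewrite wm; exact/negP.
(* Both sizes are even, so the strict inequality leaves a gap of 2. *)
rewrite card_ann (card_opp_pairs (@zdoppK n) pos_opp loop_opp); lia.
Qed.

Let half_loop v : loop v -> half v + #|loop| <= #|V|.
Proof.
move=> lv; have [w wm] := vertex_m lv.
(* The vertex [m] has [m - 1] nonzero annihilators. *)
have mV : m <= #|V| + 1.
  rewrite -[m](gcdn_idPl (dvdn_mull 3 (dvdnn m))) -{1}wm -halfE -card_ann.
  by rewrite leq_add2r max_card.
(* The cofactor [e] of the gcd in [n] is odd and not 1, and 3 does not divide it, as 9 would then
   divide [3 * m]; hence [e >= 5]. *)
have d_m : 5 * gcdn (val v) n <= 3 * m.
  have [/dvdnP[e ne] v3] := (dvdn_gcdr (val v) n, loop3 lv).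
  have d3 : 3 %| gcdn (val v) n by rewrite dvdn_gcd v3 dvdn_mulr.
  have d_lt : gcdn (val v) n < n.
    by apply: leq_ltn_trans (val_lt v); apply: dvdn_leq (dvdn_gcdl _ _).
  have e3 : ~~ (3 %| e).
    apply: contra m_mod3 => e3.
    by rewrite -(dvdn_pmul2l (p := 3)) // -/n ne dvdn_mul.
  have e_odd : odd e by move: n_odd; rewrite ne oddM => /andP[].
  rewrite -/n [leqRHS]ne leq_mul2r; apply/orP; right.
  have : e != 1 by apply/eqP => e1; move: d_lt; rewrite [ltnRHS]ne e1 mul1n ltnn.
  by case: e e3 e_odd {ne} => [|[|[|[|[|e]]]]].
(* With [d] the gcd, [half v + #|loop|] is at most [(d - 1) / 2 + (d - 3)], which is below [m - 1]
   since [d <= 3 * m / 5]. *)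
have := halfE v; have := loop_half lv; lia.
Qed.

Lemma zdgraph3m_prism :
  admits_daml (cartesian_product (zero_divisor_graph 9) (zero_divisor_graph n)).
Proof.
apply: (@prism_admits_daml (zero_divisor_graph 9) (zero_divisor_graph n)
  zdlayer9 (@zdopp n) (@zdpos n) ann).
- exact: zdlayer9_bij.
- exact: zdadj9.
- by move=> u v; rewrite /= /zdadj andbC (eq_sym u).
- exact: zdoppK.
- exact: pos_opp.
- exact: annN.
- exact: loop_opp.
- exact: half_gap.
- exact: loop_half.
- exact: half_loop.
Qed.

End ZeroDivisorGraph3m.

Theorem theorem2p13 (m : nat) (m_gt0 : 0 < m) (m_odd : odd m)
    (m_mod3 : m <> 0 %[mod 3]) :
  admits_daml (cartesian_product (zero_divisor_graph 9) (zero_divisor_graph (3 * m))).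
Proof. by apply: zdgraph3m_prism => //; apply/negP => /eqP. Qed.
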